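(* Let $\mu$ be the Hawkins random sieve probability measure on the space $X$ of strictly increasing (finite or infinite) sequences of integers greater than $1$. Let $d\ge1$ and $l\ge2$ be integers. For $\alpha\in X$ and real $x$ denote by $\Pi_{X,X+d,\ldots,X+(l-1)d}(x;\alpha)$ the number of integers $m\le x$ such that $\{m,m+d,m+2d,\ldots,m+(l-1)d\}\subset\alpha$. Then for $\mu$-almost every $\alpha\in X$, $$\Pi_{X,X+d,\ldots,X+(l-1)d}(x;\alpha)\sim\frac{x}{(\log x)^l}\qquad (x\to\infty).$$
   Context: Hawkins random sieve (Wunderlich's formulation). Let $X$ be the set of all finite (including empty) and infinite strictly increasing sequences of integers greater than $1$, identified with subsets of $\{2,3,4,\ldots\}$. For $\alpha\in X$ and an integer $n\ge 2$ put $\alpha_n=\alpha\cap\{2,3,\ldots,n-1\}$. For integers $2\le a_1<\cdots<a_r<n$ (with $r\ge 0$ and $n\geq 2$), the elementary set $\{a_1,\ldots,a_r;n\}$ is $\{\alpha\in X:\alpha_n=\{a_1,\ldots,a_r\}\}$; for $r=0$ it is written $\{.;n\}$ and consists of all sequences all of whose elements are $\ge n$. The function $\mu$ is defined recursively on elementary sets by (i) $\mu(\{.;2\})=1$; (ii) $\mu(\{a_1,\ldots,a_r,n;n+1\})=\prod_{i=1}^{r}\left(1-\frac1{a_i}\right)\mu(\{a_1,\ldots,a_r;n\})$; (iii) $\mu(\{a_1,\ldots,a_r;n+1\})=\left(1-\prod_{i=1}^{r}\left(1-\frac1{a_i}\right)\right)\mu(\{a_1,\ldots,a_r;n\})$,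 where an empty product equals $1$. It extends uniquely to a probability measure, also denoted $\mu$, on the $\sigma$-algebra generated by the elementary sets; ''almost every/almost surely'' refers to $\mu$. (Informally: given $\alpha_n$, the integer $n$ belongs to $\alpha$ with probability $\prod_{a\in\alpha_n}(1-1/a)$.) Here $f(x)\sim g(x)$ means $f(x)/g(x)\to1$. *)

(* Defs.v *)
From HB Require Import structures.
From mathcomp Require Import all_boot all_order all_algebra finmap.
From mathcomp Require Import all_classical all_reals all_analysis.

Set Implicit Arguments.
Unset Strict Implicit.
Unset Printing Implicit Defensive.
Import Order.TTheory GRing.Theory Num.Theory.
Import numFieldNormedType.Exports.
Local Open Scope classical_set_scope.
Local Open Scope ring_scope.

(* A finite or infinite strictly increasing sequence of integers greater than 1
   is encoded by the set of its terms. *)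
Definition sieve_space : Type :=
  [set A : set nat | A `<=` [set a | (2 <= a)%N]].

HB.instance Definition _ := Choice.on sieve_space.

Definition terms (alpha : sieve_space) : set nat := set_val alpha.

Definition truncation (alpha : sieve_space) (n : nat) : set nat :=
  terms alpha `&` [set a | (2 <= a < n)%N].

Definition admissible (s : seq nat) (n : nat) : bool :=
  [&& (2 <= n)%N, sorted ltn s & all (fun a => 2 <= a < n)%N s].

(* For admissible s and n this is {s_1, ..., s_r; n}. *)
Definition elementary (s : seq nat) (n : nat) : set sieve_space :=
  [set alpha | truncation alpha n = [set` s]].

Definition elementary_sets : set (set sieve_space) :=
  [set E | exists s n, admissible s n /\ E = elementary s n].

Lemma set0_sieve :
  (set0 : set nat) \in [set A : set nat | A `<=` [set a | (2 <= a)%N]].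
Proof. by rewrite inE. Qed.

(* The library requires measurable types to be pointed. *)
HB.instance Definition _ :=
  isPointed.Build sieve_space (exist _ set0 set0_sieve).

Definition sieveType := g_sigma_algebraType elementary_sets.

Definition sieve_factor (R : realType) (s : seq nat) : R :=
  \prod_(a <- s) (1 - a%:R^-1).

(* The recursion fixes the values of mu on the elementary sets, which, together
   with the empty set, are closed under intersection and generate the
   sigma-algebra; hence at most one probability satisfies it. *)
Definition is_hawkins_measure (R : realType) (mu : probability sieveType R) :=
  [/\ mu (elementary [::] 2) = 1%E,
      (forall s n, admissible s n ->
        mu (elementary (rcons s n) n.+1) =
        ((sieve_factor R s)%:E * mu (elementary s n))%E) &
      (forall s n, admissible s n ->
        mu (elementary s n.+1) =
        ((1 - sieve_factor R s)%:E * mu (elementary s n))%E)].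

(* Since the terms of alpha are natural numbers, for 0 < l it is enough to let
   m range over nat. The set is finite, so fset_set does not take its default
   value. *)
Definition progression_count (R : realType) (d l : nat) (x : R)
    (alpha : sieve_space) : nat :=
  #|` fset_set [set m : nat | m%:R <= x /\
       [set (m + i * d)%N | i in [set i | (i < l)%N]] `<=` terms alpha] |.

Definition asymptotically_equal (R : realType) (f g : R -> R) :=
  f x / g x @[x --> +oo] --> (1 : R).

(* Main.v *)
(* The integer i + 2 is encoded as the index i. Write W_k for the probability,
   given the bits before k, that bit k is set: W_k is the product of 1 - 1/(i+2)
   over the set bits i < k. Then 1/W_k - H_k is a martingale (H_k the harmonic
   number) with bounded variance, so Chebyshev and Borel-Cantelli along
   k = 2^(m^2), with monotonicity in between, give W_k ~ 1 / ln k almost surely.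
   The indicator of a progression starting at q equals W_q^l, plus l martingale
   differences, plus an error O(1/q) due to W_(q+jd) - W_q. Each of the l sums
   of martingale differences has variance at most n at time n, hence is
   O(n^(3/4)) almost surely, by Borel-Cantelli along n = k^4. Finally the sum of
   W_q^l over q < n is asymptotic to n / (ln n)^l. *)
Require Import Defs.
From mathcomp Require Import all_boot all_order all_algebra finmap.
From mathcomp Require Import all_classical all_reals all_analysis.
From mathcomp Require Import zify ring lra.
Set Implicit Arguments.
Unset Strict Implicit.
Unset Printing Implicit Defensive.
Import Order.TTheory GRing.Theory Num.Theory.
Import numFieldNormedType.Exports.
Local Open Scope classical_set_scope.
Local Open Scope ring_scope.

(** * The sieve as a process of random bits *)

Section Expectation.
Variable R : realType.
Implicit Types (b : nat -> bool) (f g : (nat -> bool) -> R).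

Definition weight (k : nat) b : R := \prod_(i < k) (1 - (b i)%:R / i.+2%:R).

Definition set_bit b (k : nat) (v : bool) : nat -> bool :=
  fun i => if i == k then v else b i.

(** Stands in for measurability with respect to the first [k] bits; [T] is [R] for random variables
    and [bool] for events. *)
Definition depends_before (T : Type) (k : nat) (f : (nat -> bool) -> T) :=
  forall b b', (forall i, (i < k)%N -> b i = b' i) -> f b = f b'.

(* Expectation of [f] when the bits before [k] are drawn successively, bit [i]
   being set with probability [weight i], and the remaining bits are unset. *)
Fixpoint expect (k : nat) f : R :=
  if k is k'.+1 then
    expect k' (fun b => weight k' b * f (set_bit b k' true) +
                        (1 - weight k' b) * f (set_bit b k' false))
  else f (fun=> false).

Lemma weightS k b : weight k.+1 b = weight k b * (1 - (b k)%:R / k.+2%:R).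
Proof. by rewrite /weight big_ord_recr. Qed.

Lemma weight_factor_itv (c : bool) k : 0 < (1 - c%:R / k.+2%:R : R) <= 1.
Proof.
case: c; rewrite ?mul0r ?subr0 ?ltr01 ?lexx// mul1r subr_gt0 gerBl invr_ge0 ler0n.
by rewrite invf_lt1 ?ltr0n// ltr1n.
Qed.

Lemma weight_gt0 k b : 0 < weight k b.
Proof. by apply: prodr_gt0 => i _; case/andP: (weight_factor_itv (b i) i). Qed.

Lemma weight_le m k b : (m <= k)%N -> weight k b <= weight m b.
Proof.
move=> /subnK <-; elim: (k - m)%N => [//|n IH].
rewrite addSn weightS; apply: le_trans IH.
by rewrite ler_piMr ?(ltW (weight_gt0 _ _)).
Qed.

Lemma weight_le1 k b : weight k b <= 1.
Proof. by have := weight_le b (leq0n k); rewrite {2}/weight big_ord0. Qed.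

Lemma weight_depends k : depends_before k (weight k).
Proof. by move=> b b' e; apply: eq_bigr => i _; rewrite e. Qed.

Lemma depends_set_bit (T : Type) k (f : (nat -> bool) -> T) b v :
  depends_before k f -> f (set_bit b k v) = f b.
Proof. by apply => i ik; rewrite /set_bit ltn_eqF. Qed.

Lemma set_bit_eq b k v : set_bit b k v k = v.
Proof. by rewrite /set_bit eqxx. Qed.

Lemma le_expect k f g : (forall b, f b <= g b) -> expect k f <= expect k g.
Proof.
elim: k f g => [|k IH] f g fg /=; first exact: fg.
by apply: IH => b; rewrite lerD// ler_wpM2l// ?subr_ge0 ?weight_le1// ltW// weight_gt0.
Qed.

Lemma eq_expect k f g : (forall b, f b = g b) -> expect k f = expect k g.
Proof. by move=> fg; congr expect; apply: funext. Qed.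

Lemma expectD k f g : expect k (fun b => f b + g b) = expect k f + expect k g.
Proof.
elim: k f g => [//|k IH] f g /=; rewrite -IH; apply: eq_expect => b; ring.
Qed.

Lemma expectZ k (c : R) f : expect k (fun b => c * f b) = c * expect k f.
Proof.
elim: k f => [//|k IH] f /=; rewrite -IH; apply: eq_expect => b; ring.
Qed.

Lemma expect_cst k (c : R) : expect k (fun=> c) = c.
Proof.
elim: k => [//|k IH] /=; rewrite -[RHS]IH; apply: eq_expect => b; ring.
Qed.

(** The martingale transform of the compensated bits by an integrand [g], predictable in the
    applications. *)
Definition centered_sum (g : nat -> (nat -> bool) -> R) (n : nat) b : R :=
  \sum_(i < n) g i b * ((b i)%:R - weight i b).

Lemma centered_sum_depends (g : nat -> (nat -> bool) -> R) n :
  (forall i, depends_before i (g i)) -> depends_before n (centered_sum g n).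
Proof.
move=> gP b b' e; apply: eq_bigr => i _; rewrite e//.
have ei j : (j < i)%N -> b j = b' j by move=> ji; apply: e; exact: ltn_trans ji _.
by rewrite (gP i _ _ ei) (weight_depends ei).
Qed.

(* The summands are martingale differences, hence pairwise orthogonal. *)
Lemma expect_centered_sum2 (g : nat -> (nat -> bool) -> R) n :
  (forall i, depends_before i (g i)) -> (forall i b, `|g i b| <= 1) ->
  expect n (fun b => centered_sum g n b ^+ 2) <= n%:R.
Proof.
move=> gP g1; elim: n => [|n IH] /=; first by rewrite /centered_sum big_ord0 expr0n.
apply: (@le_trans _ _ (expect n (fun b => centered_sum g n b ^+ 2 + 1))); last first.
  by rewrite expectD expect_cst -natr1 lerD2r.
apply: le_expect => b.
have E v : centered_sum g n.+1 (set_bit b n v) =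
    centered_sum g n b + g n b * (v%:R - weight n b).
  rewrite {1}/centered_sum big_ord_recr /= set_bit_eq.
  rewrite (depends_set_bit _ _ (gP n)) (depends_set_bit _ _ (@weight_depends n)).
  by rewrite -/(centered_sum g n _) (depends_set_bit _ _ (centered_sum_depends _)).
rewrite !E; set S := centered_sum _ _ _; set w := weight n b; set c := g n b.
have c2 : c ^+ 2 <= 1 by rewrite -real_normK ?num_real// exprn_ile1//; exact: g1.
have w0 : 0 < w := weight_gt0 _ _.
have w1 : w <= 1 := weight_le1 _ _.
(* Averaging over bit [n] cancels the cross term and leaves the conditional variance of the new
   summand. *)
have -> : w * (S + c * (true%:R - w)) ^+ 2 + (1 - w) * (S + c * (false%:R - w)) ^+ 2
  = S ^+ 2 + c ^+ 2 * (w * (1 - w)) by rewrite /=; ring.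
rewrite lerD2l mulr_ile1 ?sqr_ge0//; nra.
Qed.

(** * The reciprocal weight and the harmonic numbers *)

Definition harm (k : nat) : R := \sum_(i < k) i.+1%:R^-1.

Lemma harmS k : harm k.+1 = harm k + k.+1%:R^-1.
Proof. by rewrite /harm big_ord_recr. Qed.

(** A set bit multiplies the weight by (k+1)/(k+2), so the reciprocal grows by the fraction 1/(k+1)
    of itself. This happens with probability W_k, hence the mean growth is exactly 1/(k+1). *)
Lemma weight_inv_set_bit k b v :
  (weight k.+1 (set_bit b k v))^-1 =
  (weight k b)^-1 + v%:R * ((weight k b)^-1 / k.+1%:R).
Proof.
rewrite weightS set_bit_eq (depends_set_bit _ _ (@weight_depends k)).
have w0 : weight k b != 0 by rewrite gt_eqF// weight_gt0.
have k1 : k.+1%:R != 0 :> R by rewrite pnatr_eq0.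
have k2 : k.+2%:R != 0 :> R by rewrite pnatr_eq0.
case: v => /=; last by rewrite !mul0r subr0 mulr1 addr0.
move: k1 k2; rewrite -[k.+2%:R]natr1; move: k.+1%:R => x x0 x1.
by field; rewrite w0 x0 x1.
Qed.

Lemma expect_weight_inv k : expect k (fun b => (weight k b)^-1) = 1 + harm k.
Proof.
elim: k => [|k IH] /=; first by rewrite /weight /harm !big_ord0 invr1 addr0.
rewrite harmS addrA -IH -[X in _ + X](expect_cst k) -expectD.
apply: eq_expect => b; rewrite !weight_inv_set_bit.
have w0 : weight k b != 0 by rewrite gt_eqF// weight_gt0.
have k1 : k.+1%:R != 0 :> R by rewrite pnatr_eq0.
by move: k1 => /=; move: k.+1%:R => x x0; field; rewrite w0 x0.
Qed.

Lemma harm_le k : harm k <= k%:R.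
Proof.
elim: k => [|k IH]; first by rewrite /harm big_ord0.
by rewrite harmS -[k.+1%:R in leRHS]natr1 lerD// invf_le1 ?ltr0n// ler1n.
Qed.

(* [1/W_k - H_k] is a martingale; its variance increases by [H_k/(k+1)^2],
   which is at most the decrement of [(H_k+2)/(k+1)]. *)
Lemma expect_weight_inv_var k :
  expect k (fun b => ((weight k b)^-1 - harm k) ^+ 2) <=
  3 - (harm k + 2) / k.+1%:R.
Proof.
elim: k => [|k IH] /=; first by rewrite /weight /harm !big_ord0; lra.
have k1 : k.+1%:R != 0 :> R by rewrite pnatr_eq0.
have -> : expect k
    (fun b => weight k b * ((weight k.+1 (set_bit b k true))^-1 - harm k.+1) ^+ 2 +
       (1 - weight k b) * ((weight k.+1 (set_bit b k false))^-1 - harm k.+1) ^+ 2) =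
    expect k (fun b => ((weight k b)^-1 - harm k) ^+ 2) + harm k / k.+1%:R ^+ 2.
  (* Given the earlier bits, the martingale increment (v/W_k - 1)/(k+1) has variance (1/W_k -
     1)/(k+1)^2; the mean of 1/W_k - 1 is H_k. *)
  have -> : harm k / k.+1%:R ^+ 2 =
      expect k (fun b => (k.+1%:R ^+ 2)^-1 * ((weight k b)^-1 + -1)).
    by rewrite expectZ expectD expect_cst expect_weight_inv addrAC subrr add0r mulrC.
  rewrite -expectD; apply: eq_expect => b; rewrite !weight_inv_set_bit harmS.
  have w0 : weight k b != 0 by rewrite gt_eqF// weight_gt0.
  by move: k1 => /=; move: k.+1%:R => x x0; field; rewrite w0 x0.
apply: (le_trans (lerD IH (lexx (harm k / k.+1%:R ^+ 2)))).
have hk := harm_le k; rewrite harmS.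
rewrite -lerBDr -subr_ge0.
have -> : 3 - (harm k + k.+1%:R^-1 + 2) / k.+2%:R - harm k / k.+1%:R ^+ 2 -
    (3 - (harm k + 2) / k.+1%:R) =
   (k.+1%:R - harm k) / (k.+1%:R ^+ 2 * k.+2%:R).
  have: k.+2%:R != 0 :> R by rewrite pnatr_eq0.
  by move: k1; rewrite -[k.+2%:R]natr1; move: k.+1%:R => x x0 x1; field; rewrite x1 x0.
rewrite divr_ge0 ?mulr_ge0 ?sqr_ge0 ?ler0n// subr_ge0 (le_trans hk)// ler_nat.
exact: leqnSn.
Qed.

Lemma expect_weight_inv_var_le3 k :
  expect k (fun b => ((weight k b)^-1 - harm k) ^+ 2) <= 3.
Proof.
apply: le_trans (expect_weight_inv_var k) _; rewrite gerBl divr_ge0 ?ler0n// addr_ge0//.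
by rewrite sumr_ge0// => i _; rewrite invr_ge0 ler0n.
Qed.

End Expectation.

(** * Comparison with the sieve measure *)

Definition bits (alpha : sieve_space) : nat -> bool :=
  fun i => `[< terms alpha i.+2 >].

Definition seq_bits (s : seq nat) : nat -> bool := fun i => i.+2 \in s.

(** Follows the recursion of [is_hawkins_measure]: each stage splits a prefix according to whether
    the next integer is left out or kept. *)
Fixpoint prefixes (k : nat) : seq (seq nat) :=
  if k is k'.+1 then prefixes k' ++ [seq rcons s k'.+2 | s <- prefixes k']
  else [:: [::]].

Lemma prefixes_admissible k s : s \in prefixes k -> admissible s k.+2.
Proof.
elim: k s => [|k IH] s /=; first by rewrite inE => /eqP ->.
rewrite mem_cat => /orP[/IH /and3P[_ so /allP al]|/mapP[t /IH /and3P[_ so /allP al] ->]].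
  apply/and3P; split=> //; apply/allP => a /al /andP[-> ak].
  exact: ltn_trans ak _.
apply/and3P; split=> //.
  case: t so al => [//|a t] /= so al; rewrite rcons_path so /=.
  by case/andP: (al _ (mem_last a t)).
rewrite all_rcons /= ltnS leqnn /=; apply/allP => a /al /andP[-> ak].
exact: ltn_trans ak _.
Qed.

Lemma prefixes_fresh k s : s \in prefixes k -> seq_bits s k = false.
Proof.
move=> /prefixes_admissible/and3P[_ _ /allP al].
by apply/negP => /al; rewrite ltnn andbF.
Qed.

Lemma set_bit_false k s : s \in prefixes k ->
  set_bit (seq_bits s) k false = seq_bits s.
Proof.
move=> /prefixes_fresh sk; apply: funext => i; rewrite /set_bit.
by case: eqVneq => // ->.
Qed.

Lemma set_bit_true k s : set_bit (seq_bits s) k true = seq_bits (rcons s k.+2).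
Proof.
by apply: funext => i; rewrite /set_bit /seq_bits mem_rcons inE !eqSS; case: eqP.
Qed.

Lemma sieve_factor_weight (R : realType) k s : s \in prefixes k ->
  sieve_factor R s = weight R k (seq_bits s).
Proof.
elim: k s => [|k IH] s /=.
  by rewrite inE => /eqP ->; rewrite /sieve_factor /weight big_nil big_ord0.
rewrite mem_cat => /orP[sk|/mapP[t tk ->]]; rewrite weightS.
  by rewrite (prefixes_fresh sk) mul0r subr0 mulr1 IH.
rewrite -set_bit_true set_bit_eq (depends_set_bit _ _ (@weight_depends _ _)) -IH//.
rewrite /sieve_factor -cats1 big_cat big_seq1 /=.
by rewrite div1r.
Qed.

(** Makes the elementary sets of a single level cover the space, so that an event determined by the
    first [k] bits is a union of some of them. *)
Lemma truncation_prefix (alpha : sieve_space) k :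
  exists2 s, s \in prefixes k & truncation alpha k.+2 = [set` s].
Proof.
elim: k => [|k [s sk E]].
  exists [::]; first by rewrite inE.
  by apply/seteqP; split=> a //= -[_ /= /andP[a2]]; rewrite ltnNge a2.
have step a : truncation alpha k.+3 a <->
    truncation alpha k.+2 a \/ (a = k.+2 /\ terms alpha a).
  split.
  - case=> ta /=; rewrite ltnS => /andP[a2]; rewrite leq_eqVlt => /orP[/eqP ak|ak].
    + by right; rewrite -ak.
    + by left; split=> //=; rewrite a2.
  - case=> [[ta /= /andP[a2 ak]]|[-> ta]]; split=> //=.
    by rewrite a2 (ltn_trans ak).
case: (pselect (terms alpha k.+2)) => tk.
  exists (rcons s k.+2); first by rewrite /= mem_cat; apply/orP; right; apply/mapP; exists s.
  apply/seteqP; split=> a /=.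
    move/step; rewrite E /= mem_rcons inE => -[->|[-> _]]; rewrite ?orbT ?eqxx//.
  rewrite mem_rcons inE => /orP[/eqP ->|sa]; apply/step; first by right.
  by left; rewrite E.
exists s; first by rewrite /= mem_cat sk.
rewrite -E; apply/seteqP; split=> a; last by move=> ta; apply/step; left.
by move/step => -[//|[ak]]; rewrite ak.
Qed.

Lemma bits_truncation (alpha : sieve_space) k s i : (i < k)%N ->
  truncation alpha k.+2 = [set` s] -> bits alpha i = seq_bits s i.
Proof.
move=> ik E; rewrite /bits /seq_bits.
have : truncation alpha k.+2 i.+2 <-> [set` s] i.+2 by rewrite E.
rewrite /truncation /= !ltnS ik => -[h1 h2].
apply/asboolP/idP => [ta|si]; [exact: h1|by case: (h2 si)].
Qed.

Lemma sum_inv_sqr_le2 (R : realType) n : \sum_(k < n) (k.+1%:R ^+ 2)^-1 <= 2 :> R.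
Proof.
(* The strengthened bound grows by 1/(n+1/2) - 1/(n+3/2) = 1/((n+1)^2 - 1/4), which exceeds
   1/(n+1)^2. *)
suff : \sum_(k < n) (k.+1%:R ^+ 2)^-1 <= 2 - 2 / (2 * n%:R + 1) :> R.
  by move/le_trans; apply; rewrite gerBl divr_ge0// addr_ge0// mulr_ge0.
elim: n => [|n IH]; first by rewrite big_ord0 mulr0 add0r divr1 subrr.
rewrite big_ord_recr /=; apply: (le_trans (lerD IH (lexx _))).
rewrite -[n.+1%:R]natr1; have n0 : 0 <= n%:R :> R by [].
move: n0; move: n%:R => x x0.
rewrite -subr_ge0.
have -> : 2 - 2 / (2 * (x + 1) + 1) - (2 - 2 / (2 * x + 1) + ((x + 1) ^+ 2)^-1) =
  ((2 * (x + 1) + 1) * (2 * x + 1) * (x + 1) ^+ 2)^-1.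
  by field; rewrite !gt_eqF//; lra.
by rewrite invr_ge0 !mulr_ge0 ?sqr_ge0//; lra.
Qed.

(** * Expectations under the sieve measure and Borel-Cantelli *)

Section Measure.
Variables (R : realType) (mu : probability sieveType R).
Hypothesis hmu : is_hawkins_measure mu.

Lemma measurable_elementary k s : s \in prefixes k ->
  measurable (elementary s k.+2 : set sieveType).
Proof.
move=> /prefixes_admissible sk; apply: sub_sigma_algebra.
by exists s, k.+2.
Qed.

(** The recursion rules of the measure divide the mass of each prefix exactly as one step of
    [expect] does. *)
Lemma expect_prefixes k (f : (nat -> bool) -> R) :
  expect k f = \sum_(s <- prefixes k)
    f (seq_bits s) * fine (mu (elementary s k.+2)).
Proof.
have [h0 h1 h2] := hmu.
elim: k f => [|k IH] f /=.
  rewrite big_seq1 h0 /= mulr1; congr f.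
rewrite IH big_cat /= big_map -big_split /= big_seq [RHS]big_seq.
apply: eq_bigr => s sk.
have sa := prefixes_admissible sk.
rewrite set_bit_false// set_bit_true -(sieve_factor_weight R sk) (h1 _ _ sa) (h2 _ _ sa).
rewrite !fineM//; try by apply: fin_num_measure; exact: measurable_elementary.
by rewrite /=; ring.
Qed.

(** Written as a finite union of elementary sets so that measurability is immediate. *)
Definition prefix_event k (P : (nat -> bool) -> bool) : set sieveType :=
  \big[setU/set0]_(s <- prefixes k | P (seq_bits s)) elementary s k.+2.

Lemma measurable_prefix_event k P : measurable (prefix_event k P).
Proof.
rewrite /prefix_event big_seq_cond; apply: bigsetU_measurable => s /andP[sk _].
exact: measurable_elementary.
Qed.

Lemma prefix_eventP k (P : (nat -> bool) -> bool) (alpha : sieveType) :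
  depends_before k P -> P (bits alpha) -> prefix_event k P alpha.
Proof.
move=> Pk Pa; have [s sk E] := truncation_prefix alpha k.
rewrite /prefix_event -bigcup_seq_cond.
exists s => //=; rewrite sk /= -(Pk (bits alpha))// => i ik.
exact: bits_truncation ik E.
Qed.

(** Markov's inequality, applied prefix by prefix and summed by subadditivity. *)
Lemma measure_prefix_event k (f : (nat -> bool) -> R) (c : R) : 0 < c ->
  (forall b, 0 <= f b) ->
  (mu (prefix_event k (fun b => c <= f b)%R) <= (expect k f / c)%:E)%E.
Proof.
move=> c0 f0; rewrite expect_prefixes mulr_suml -sumEFin /prefix_event.
have : {subset prefixes k <= prefixes k} by [].
(* The induction runs over any list contained in [prefixes k]; the inclusion keeps the elementary
   sets measurable. *)
move: {1 3 4}(prefixes k) => l; elim: l => [_|s l IH sub].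
  by rewrite !big_nil measure0.
have sk : s \in prefixes k by apply: sub; exact: mem_head.
have lk : {subset l <= prefixes k} by move=> t tl; apply: sub; rewrite inE tl orbT.
have q0 : 0 <= fine (mu (elementary s k.+2)) by exact: fine_ge0.
have mU : measurable (\big[setU/set0]_(j <- l | c <= f (seq_bits j))
   (elementary j k.+2 : set sieveType)).
  rewrite big_seq_cond; apply: bigsetU_measurable => t /andP[tl _].
  by apply: measurable_elementary; exact: lk.
rewrite !big_cons; case: ifPn => cf.
  apply: le_trans (measureU2 _ _ _) _ => //; first exact: measurable_elementary.
  apply: leeD; last exact: IH.
  rewrite -[leLHS]fineK; last by apply: fin_num_measure; exact: measurable_elementary.
  by rewrite lee_fin mulrAC ler_peMl// ler_pdivlMr// mul1r.
apply: le_trans (IH lk) _; rewrite leeDr// lee_fin.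
by rewrite mulr_ge0 ?invr_ge0 ?(ltW c0)// mulr_ge0.
Qed.

(** By Chebyshev the event |f_k| >= k+1 has measure at most C/(k+1)^2, which is summable;
    Borel-Cantelli then makes the limsup of these events null. *)
Lemma ae_eventually_lt (C : R) (n : nat -> nat) (f : nat -> (nat -> bool) -> R) :
  (forall k, depends_before (n k) (f k)) ->
  (forall k, expect (n k) (fun b => f k b ^+ 2) <= C) ->
  {ae mu, forall alpha : sieveType,
    exists K, forall k, (K <= k)%N -> `|f k (bits alpha)| < k.+1%:R}.
Proof.
move=> fn fC.
pose E k := prefix_event (n k) (fun b => k.+1%:R ^+ 2 <= f k b ^+ 2).
have mE k : measurable (E k) by exact: measurable_prefix_event.
exists (lim_sup_set E); split.
- by apply: bigcap_measurable => // i _; apply: bigcup_measurable => j _.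
- apply: lim_sup_set_cvg0 => //.
  have : (\sum_(k <oo) mu (E k) <= \sum_(k <oo) (C / k.+1%:R ^+ 2)%:E)%E.
    apply: lee_nneseries => // k _.
    have k0 : 0 < k.+1%:R ^+ 2 :> R by rewrite exprn_gt0.
    have := measure_prefix_event (n k) k0 (fun b => sqr_ge0 (f k b)).
    by move/le_trans; apply; rewrite lee_fin ler_pM2r// invr_gt0.
  move/le_lt_trans; apply.
  have C0 : 0 <= C.
    apply: le_trans (fC 0); rewrite -(expect_cst (n 0) 0).
    by apply: le_expect => b; exact: sqr_ge0.
  apply: (@le_lt_trans _ _ (C * 2)%:E); last exact: ltry.
  apply: lime_le; first by apply: is_cvg_nneseries => k _ _; rewrite lee_fin divr_ge0.
  apply: nearW => N; rewrite big_mkord sumEFin lee_fin -mulr_sumr.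
  by rewrite ler_wpM2l// sum_inv_sqr_le2.
- move=> alpha /= nH k _; apply: contrapT => nE; apply: nH.
  exists k => j kj; rewrite ltNge; apply/negP => jf; apply: nE.
  exists j => //=; apply: prefix_eventP.
    by move=> b b' e; rewrite (fn j _ _ e).
  by rewrite -[leRHS]real_normK ?num_real// lerXn2r ?nnegrE.
Qed.
End Measure.

(** * Counting progressions through martingale sums *)

Section Deterministic.
Variable R : realType.
Implicit Types (b : nat -> bool) (d l j n : nat).

(* Multiplied by [b i - weight i b], this is the [j]-th martingale difference in
   the expansion [prod_telescope] for the progression starting at [i - j * d];
   it vanishes when that start would be negative. *)
Definition partial_pattern d l j (i : nat) b : R :=
  if (j * d <= i)%N then
    (\prod_(r < j) (b (i - j * d + r * d)%N)%:R) *
      weight R (i - j * d) b ^+ (l.-1 - j)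
  else 0.

Lemma partial_pattern_depends d l j i : (0 < d)%N ->
  depends_before i (partial_pattern d l j i).
Proof.
move=> d0 b b' e; rewrite /partial_pattern; case: ifPn => // ji; congr (_ * _).
  apply: eq_bigr => r _; rewrite e// -ltn_subRL subKn//.
  by rewrite ltn_mul2r d0 /=.
congr (_ ^+ _); apply: weight_depends => r ri; apply: e.
by apply: leq_trans ri _; exact: leq_subr.
Qed.

Lemma partial_pattern_le1 d l j i b : `|partial_pattern d l j i b| <= 1.
Proof.
rewrite /partial_pattern; case: ifP => _; last by rewrite normr0.
have w0 : 0 <= weight R (i - j * d) b by rewrite ltW// weight_gt0.
rewrite normrM normr_prod mulr_ile1// ?prodr_ge0//.
  by apply: prodr_ile1 => r; rewrite normr_nat ler0n lern1 leq_b1.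
by rewrite ger0_norm ?exprn_ge0// exprn_ile1// weight_le1.
Qed.

(** Consecutive hybrids, with the first [j] factors kept and the others replaced by [w], differ by
    the [j]-th summand. *)
Lemma prod_telescope l (beta : nat -> R) (w : R) :
  \prod_(i < l) beta i = w ^+ l +
    \sum_(j < l) (\prod_(i < j) beta i) * w ^+ (l.-1 - j) * (beta j - w).
Proof.
elim: l => [|l IH]; first by rewrite !big_ord0 expr0 addr0.
rewrite !big_ord_recr /= subnn expr0 mulr1.
have -> : \sum_(j < l) \prod_(i < j) beta i * w ^+ (l - j) * (beta j - w) =
   w * \sum_(j < l) \prod_(i < j) beta i * w ^+ (l.-1 - j) * (beta j - w).
  rewrite mulr_sumr; apply: eq_bigr => -[j jl] _ /=.
  by case: l jl {IH} => //= l jl; rewrite subSn// exprS; ring.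
by rewrite IH exprS; ring.
Qed.

(** Each of the [m] steps lowers the weight by at most 1/(q+1), since the integers concerned exceed
    q+1. *)
Lemma weight_dist q m b : `|weight R (q + m) b - weight R q b| <= m%:R / q.+1%:R.
Proof.
rewrite distrC ger0_norm ?subr_ge0 ?weight_le ?leq_addr//.
elim: m => [|m IH]; first by rewrite addn0 subrr mul0r.
rewrite addnS weightS -[m.+1%:R]natr1 mulrDl mul1r.
rewrite mulrBr mulr1 opprB addrA addrAC lerD//.
rewrite -[leRHS]mul1r ler_pM ?divr_ge0 ?weight_le1 ?(ltW (weight_gt0 _ _ _))//.
rewrite -[leRHS]mul1r ler_pM ?invr_ge0 ?lern1 ?leq_b1// lef_pV2 ?posrE// ler_nat.
by rewrite !ltnS (leq_trans (leq_addr m q))// leqnSn.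
Qed.

(** The expansion subtracts W_q from every bit, whereas a martingale difference at bit q+jd
    subtracts W_(q+jd). Each of the [l] exchanges costs at most ld/(q+1), and summing over [q] gives
    the harmonic number. *)
Lemma pattern_sum_dist d l n b :
  `|\sum_(q < n) \prod_(i < l) (b (q + i * d)%N)%:R - \sum_(q < n) weight R q b ^+ l
    - \sum_(j < l) centered_sum (partial_pattern d l j) (j * d + n) b|
  <= (l * (l * d))%:R * harm R n.
Proof.
have -> : \sum_(j < l) centered_sum (partial_pattern d l j) (j * d + n) b =
   \sum_(q < n) \sum_(j < l) (\prod_(i < j) (b (q + i * d)%N)%:R) *
       weight R q b ^+ (l.-1 - j) * ((b (q + j * d)%N)%:R - weight R (q + j * d) b).
  rewrite exchange_big; apply: eq_bigr => j _.
  (* The first [j * d] summands vanish; the others are reindexed by the start [q] of the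
     progression. *)
  rewrite /centered_sum big_split_ord /= big1 ?add0r; last first.
    by move=> i _; rewrite /partial_pattern leqNgt ltn_ord mul0r.
  apply: eq_bigr => q _; rewrite /partial_pattern leq_addr addKn addnC.
  by [].
rewrite -!sumrB /harm mulr_sumr; apply: le_trans (ler_norm_sum _ _ _) _.
apply: ler_sum => q _.
rewrite (@prod_telescope l (fun i => (b (q + i * d)%N)%:R) (weight R q b)).
rewrite (addrC (weight R q b ^+ l)) addrK -sumrB; apply: le_trans (ler_norm_sum _ _ _) _.
have -> : (l * (l * d))%:R * (q.+1%:R)^-1 =
    \sum_(j < l) ((l * d)%:R * (q.+1%:R)^-1) :> R.
  by rewrite sumr_const card_ord -[RHS]mulr_natl natrM mulrA.
apply: ler_sum => j _; rewrite -mulrBr opprB [X in _ * X]addrC addrA subrK.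
rewrite normrM -[leRHS]mul1r ler_pM//.
  have := partial_pattern_le1 d l j (j * d + q) b.
  by rewrite /partial_pattern leq_addr addKn.
apply: le_trans (weight_dist _ _ _) _.
by rewrite ler_pM2r ?invr_gt0// ler_nat leq_mul2r (ltnW (ltn_ord j)) orbT.
Qed.

Lemma sum_weight_ge l n N b : (n <= N)%N ->
  n%:R * weight R N b ^+ l <= \sum_(q < n) weight R q b ^+ l.
Proof.
move=> nN; rewrite mulr_natl -[n in leLHS]card_ord -sumr_const.
apply: ler_sum => q _; apply: lerXn2r; rewrite ?nnegrE ?(ltW (weight_gt0 _ _ _))//.
by apply: weight_le; exact: leq_trans (ltnW (ltn_ord q)) nN.
Qed.

(** The first [M] terms are at most 1 and the later ones, by monotonicity, at most the term at [M];
    [M] may exceed [n]. *)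
Lemma sum_weight_le l n M b :
  \sum_(q < n) weight R q b ^+ l <= M%:R + n%:R * weight R M b ^+ l.
Proof.
have w0 m : 0 <= weight R m b by rewrite ltW// weight_gt0.
elim: n M => [|n IH] M; first by rewrite big_ord0 mul0r addr0.
rewrite big_ord_recr /= -[in leRHS]natr1 mulrDl mul1r.
have [Mn|nM] := leqP M n.
  by rewrite addrA lerD// lerXn2r ?nnegrE// weight_le.
case: M nM => // M nM; rewrite -natr1.
apply: (@le_trans _ _ (n%:R + 1)).
  rewrite lerD ?exprn_ile1 ?weight_le1//.
  rewrite -[n in leRHS]card_ord -[leRHS]mulr1 mulr_natl -sumr_const.
  by apply: ler_sum => q _; rewrite exprn_ile1 ?weight_le1.
rewrite -addrA lerD ?ler_nat// lerDl.
by rewrite addr_ge0 ?mulr_ge0 ?exprn_ge0.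
Qed.

Lemma centered_sum_lipschitz (g : nat -> (nat -> bool) -> R) n m b :
  (forall i b, `|g i b| <= 1) ->
  `|centered_sum g (n + m) b - centered_sum g n b| <= m%:R.
Proof.
move=> g1; rewrite /centered_sum big_split_ord /= addrAC subrr add0r.
apply: le_trans (ler_norm_sum _ _ _) _.
rewrite -[m in leRHS]card_ord -[leRHS]mulr1 mulr_natl -sumr_const.
apply: ler_sum => i _; rewrite normrM mulr_ile1// ler_norml.
have := weight_le1 R (n + i) b; have := weight_gt0 R (n + i) b.
by case: (b (n + i)%N) => /=; lra.
Qed.

Lemma fourth_root n : exists k, (k ^ 4 <= n < k.+1 ^ 4)%N.
Proof.
elim: n => [|n [k /andP[kn nk]]]; first by exists 0%N.
have [nk1|] := ltnP n.+1 (k.+1 ^ 4); first by exists k; rewrite nk1 leqW.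
move=> kn1; exists k.+1; rewrite kn1 /=; apply: leq_ltn_trans nk _.
by rewrite ltn_exp2r.
Qed.

(* On [k^4 <= n < (k+1)^4] a 1-Lipschitz sequence varies by [O(k^3) = O(n^(3/4))]. *)
Lemma lipschitz_growth (S : nat -> R) (a K : nat) : S 0%N = 0 ->
  (forall n m, `|S (n + m)%N - S n| <= m%:R) ->
  (forall k, (K <= k)%N -> `|S (k ^ 4)%N| <= k%:R ^+ 3) ->
  exists2 C, 0 <= C & forall n x, 1 <= x -> n%:R <= x ->
    `|S (a + n)%N| <= C * expR (3 / 4 * ln x).
Proof.
move=> S0 SL SK; exists (16 + (a + 1 + K ^ 4)%:R); first by rewrite addr_ge0.
(* The coefficient 16 is 15, from (k+1)^4 - k^4 <= 15k^3 + 1, plus 1 from the bound at k^4; the rest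
   absorbs the shift [a] and the range below [K ^ 4]. *)
move=> n x x1 nx; have [k /andP[kn nk]] := fourth_root n.
have lnx0 : 0 <= ln x by exact: ln_ge0.
have e1 : 1 <= expR (3 / 4 * ln x).
  by rewrite -expR0 ler_expR mulr_ge0.
have ke : k%:R ^+ 3 <= expR (3 / 4 * ln x).
  case: k kn {nk} => [|k] kn; first by rewrite expr0n ltW// expR_gt0.
  rewrite -[k.+1%:R](@lnK R) ?posrE// -expRM_natl ler_expR.
  have : ln (k.+1%:R ^+ 4) <= ln x.
    rewrite ler_ln ?posrE ?exprn_gt0 ?(lt_le_trans _ x1)//.
    by apply: le_trans nx; rewrite -natrX ler_nat.
  rewrite lnXn// -mulr_natl; lra.
suff H : `|S (a + n)%N| <= 16 * k%:R ^+ 3 + (a + 1 + K ^ 4)%:R.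
  apply: le_trans H _; rewrite [leRHS]mulrDl lerD ?ler_wpM2l//.
  by rewrite ler_peMr.
have [Kk|kK] := leqP K k.
  have -> : S (a + n)%N = (S (k ^ 4 + (a + (n - k ^ 4)))%N - S (k ^ 4)%N) + S (k ^ 4)%N.
    by rewrite subrK; congr S; lia.
  apply: le_trans (ler_normD _ _) _.
  apply: le_trans (lerD (SL _ _) (SK _ Kk)) _.
  have -> : 16 * k%:R ^+ 3 + (a + 1 + K ^ 4)%:R =
     (15 * k ^ 3 + a + 1 + K ^ 4)%:R + k%:R ^+ 3 :> R.
    by rewrite !natrD natrM !natrX; ring.
  rewrite lerD2r ler_nat.
  have : (n < k ^ 4 + (15 * k ^ 3) + 1)%N.
    apply: leq_trans nk _; rewrite !expnS expn0 !muln1; nia.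
  lia.
have := SL 0%N (a + n)%N; rewrite add0n S0 subr0 => /le_trans; apply.
apply: (@le_trans _ _ (a + 1 + K ^ 4)%:R); last first.
  by rewrite lerDr mulr_ge0// exprn_ge0.
rewrite ler_nat; have : (k.+1 ^ 4 <= K ^ 4)%N by rewrite leq_exp2r.
move=> h; rewrite -addnA leq_add2l; apply: ltnW.
by apply: leq_trans nk _; rewrite (leq_trans h) ?leq_addl.
Qed.

End Deterministic.

(** * Asymptotics *)

Section Asymptotics.
Variable R : realType.
Implicit Types (b : nat -> bool) (l : nat) (x t : R).

Lemma cvg_pinfty_near_eq (f g : R -> R) (a : R) :
  (\forall x \near +oo, f x = g x) ->
  f x @[x --> +oo] --> a -> g x @[x --> +oo] --> a.
Proof.
by move=> fg; apply: cvg_trans; apply: near_eq_cvg; apply: filterS fg => x ->.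
Qed.

Lemma near_ln_ge (A : R) : \forall x \near +oo, A <= ln x.
Proof.
by near=> x; rewrite -[A]expRK ler_ln ?posrE ?expR_gt0//.
Unshelve. all: by end_near. Qed.

Lemma cvg_ln_pinfty : ln x @[x --> +oo] --> (+oo : set_system R).
Proof. by apply/cvgryPge => A; exact: near_ln_ge. Qed.

Lemma near_sqrt_ge (A : R) : \forall t \near +oo, A <= Num.sqrt t.
Proof.
near=> t; apply: le_trans (ler_norm A) _; rewrite -(ger0_norm (normr_ge0 A)) -sqrtr_sqr.
by apply: ler_wsqrtr; near: t; exact: nbhs_pinfty_ge.
Unshelve. all: by end_near. Qed.

(** With s = sqrt t this concerns s^(2p) e^(-s); a single term of the exponential series,
    s^(2p+1)/(2p+1)! <= e^s, suffices. *)
Lemma cvg_expr_expRN_sqrt (p : nat) :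
  t ^+ p * expR (- Num.sqrt t) @[t --> +oo] --> (0 : R).
Proof.
apply/cvgr0Pnorm_le => e e0; near=> t.
have t0 : 0 <= t by near: t; exact: nbhs_pinfty_ge.
have s1 : 1 <= Num.sqrt t by near: t; exact: near_sqrt_ge.
have se : ((p * 2).+1`!)%:R / e <= Num.sqrt t by near: t; exact: near_sqrt_ge.
move: s1 se; set s := Num.sqrt t => s1 se.
have ts : t = s ^+ 2 by rewrite sqr_sqrtr.
have s0 : 0 < s := lt_le_trans ltr01 s1.
rewrite ger0_norm ?mulr_ge0 ?exprn_ge0 ?expR_ge0//.
rewrite ts -exprM mulnC expRN ler_pdivrMr ?expR_gt0//.
have := expR_ge1Dxn (p * 2) (ltW s0); set F := _%:R => h.
have F0 : 0 < F by rewrite ltr0n fact_gt0.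
have {}h : s ^+ (p * 2).+1 <= F * expR s.
  by rewrite mulrC -ler_pdivrMr//; lra.
move: se; rewrite ler_pdivrMr// => se.
rewrite -(ler_pM2l s0) -exprS; apply: le_trans h _.
by rewrite mulrA ler_wpM2r// expR_ge0.
Unshelve. all: by end_near. Qed.

(** Both inductions use ln(1+u) <= u, with u = 1/(n+1) and u = -1/(n+2). *)
Lemma ln_harm n : ln n.+1%:R <= harm R n /\ harm R n.+1 <= 1 + ln n.+1%:R.
Proof.
elim: n => [|n [IH1 IH2]].
  by rewrite harmS /harm big_ord0 ln1 add0r addr0 invr1 lexx.
have n1 : 0 < n.+1%:R :> R by rewrite ltr0n.
have n2 : 0 < n.+2%:R :> R by rewrite ltr0n.
split.
  rewrite harmS; have -> : n.+2%:R = n.+1%:R * (1 + n.+1%:R^-1) :> R.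
    by rewrite mulrDr mulr1 mulfV ?gt_eqF// natr1.
  have i0 : 0 < n.+1%:R^-1 :> R by rewrite invr_gt0.
  rewrite lnM ?posrE ?addr_gt0// lerD// le_ln1Dx//; exact: lt_trans (ltrN10 R) i0.
rewrite [X in X <= _]harmS.
suff : n.+2%:R^-1 <= ln n.+2%:R - ln n.+1%:R :> R.
  move: IH2; move: (harm R _) (ln n.+1%:R) (ln n.+2%:R) (n.+2%:R^-1) => h u v w; lra.
have -> : n.+1%:R = n.+2%:R * (1 - n.+2%:R^-1) :> R.
  by rewrite mulrBr mulr1 mulfV ?gt_eqF// -[n.+2%:R]natr1 addrK.
have i1 : n.+2%:R^-1 < 1 :> R by rewrite invf_lt1// ltr1n.
rewrite lnM ?posrE ?subr_gt0//.
suff : ln (1 - n.+2%:R^-1) <= - n.+2%:R^-1 :> R.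
  move: (ln (1 - n.+2%:R^-1 : R)) (ln n.+2%:R) (n.+2%:R^-1) => u v w; lra.
by apply: le_ln1Dx; rewrite ltrN2.
Qed.

Lemma weight_inv_le m k b : (m <= k)%N -> (weight R m b)^-1 <= (weight R k b)^-1.
Proof. by move=> mk; rewrite lef_pV2 ?posrE ?weight_gt0// weight_le. Qed.

(* Since 1/W is monotone, it suffices to control it along [2^(k^2)]: the
   logarithms of consecutive terms have ratio tending to 1, and [k+1] is
   negligible against [k^2]. *)
Lemma weight_inv_ln b K :
  (forall k, (K <= k)%N ->
     `|(weight R (2 ^ (k ^ 2)) b)^-1 - harm R (2 ^ (k ^ 2))| < k.+1%:R) ->
  (weight R (Num.truncn x) b)^-1 / ln x @[x --> +oo] --> (1 : R).
Proof.
move=> HK; apply/cvgrPdist_le => e e0.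
pose c := ln 2 : R.
have c0 : 0 < c by rewrite ln_gt0// ltr1n.
have c1 : c <= 1.
  rewrite /c; have -> : 2 = 1 + 1 :> R by [].
  by apply: le_ln1Dx; lra.
near=> x.
have x0 : 0 < x by near: x; exact: nbhs_pinfty_gt.
have t0 : 0 <= ln x by near: x; exact: near_ln_ge.
have tK : c * K.+1%:R ^+ 2 <= ln x by near: x; exact: near_ln_ge.
have te : c * (7 / (e * c) + 1) ^+ 2 <= ln x by near: x; exact: near_ln_ge.
move: t0 tK te; set t := ln x => t0 tK te.
(* Here s^2 is the base 2 logarithm of [x], so its integer part [k] satisfies 2^(k^2) <= x <
   2^((k+1)^2). *)
pose s := Num.sqrt (t / c).
have s0 : 0 <= s by exact: sqrtr_ge0.
have ts : t = c * s ^+ 2.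
  by rewrite sqr_sqrtr ?divr_ge0 ?(ltW c0)// mulrC divfK// gt_eqF.
have sA (A : R) : c * A ^+ 2 <= t -> A <= s.
  move=> At; apply: le_trans (ler_norm A) _.
  rewrite -sqrtr_sqr; apply: ler_wsqrtr.
  by rewrite ler_pdivlMr// mulrC.
have [k /andP[ks sk]] : exists k : nat, k%:R <= s < k.+1%:R.
  by exists (Num.truncn s); exact: truncn_itv.
have kK : (K.+1 <= k)%N.
  rewrite -ltnS -(ltr_nat R); apply: le_lt_trans sk.
  exact: sA.
have ke : 7 <= e * (c * k%:R).
  have : 7 / (e * c) + 1 <= s by exact: sA.
  rewrite -[k.+1%:R]natr1 in sk => h; rewrite mulrA mulrC -ler_pdivrMr ?mulr_gt0//.
  by lra.
have k1 : 1 <= k%:R :> R by rewrite ler1n (leq_trans _ kK).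
have k0 : 0 < k%:R :> R := lt_le_trans ltr01 k1.
have t1 : c * k%:R ^+ 2 <= t by rewrite ts ler_pM2l// lerXn2r// nnegrE.
have t2 : t <= c * k.+1%:R ^+ 2.
  by rewrite ts ler_pM2l// lerXn2r// ?nnegrE// ltW.
have tpos : 0 < t by apply: lt_le_trans t1; rewrite mulr_gt0// exprn_gt0.
have lnpow m : ln (2 ^ (m ^ 2))%:R = c * m%:R ^+ 2 :> R.
  by rewrite natrX lnXn// -[LHS]mulr_natl natrX mulrC.
have pos2 m : 0 < (2 ^ (m ^ 2))%:R :> R by rewrite ltr0n expn_gt0.
have n1 : (2 ^ (k ^ 2) <= Num.truncn x)%N.
  by rewrite truncn_ge_nat ?(ltW x0)// -ler_ln ?posrE// lnpow.
have n2 : (Num.truncn x <= 2 ^ (k.+1 ^ 2))%N.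
  rewrite -(ler_nat R); apply: (@le_trans _ _ x); first by rewrite truncn_le ltW.
  by rewrite -ler_ln ?posrE// lnpow.
have z1 := weight_inv_le b n1; have z2 := weight_inv_le b n2.
set z := (weight R (Num.truncn x) b)^-1 in z1 z2 *.
have h1 : c * k%:R ^+ 2 <= harm R (2 ^ (k ^ 2)).
  have [+ _] := ln_harm (2 ^ (k ^ 2)); apply: le_trans.
  by rewrite -lnpow ler_ln ?posrE// ler_nat.
have h2 : harm R (2 ^ (k.+1 ^ 2)) <= 1 + c * k.+1%:R ^+ 2.
  rewrite -lnpow; have : (0 < 2 ^ (k.+1 ^ 2))%N by rewrite expn_gt0.
  by case: (2 ^ (k.+1 ^ 2))%N => // m _; have [] := ln_harm m.
have := HK k (ltnW kK); have := HK k.+1 (leqW (ltnW kK)).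
rewrite !ltr_norml => /andP[_ g2] /andP[g1 _].
move: g1 g2 h2 t2; rewrite -[k.+2%:R]natr1 -[k.+1%:R]natr1.
move: (k%:R) k1 k0 ke t1 h1 => y y1 y0 ye t1 h1 g1 g2 h2 t2.
have cy : c * y <= y by rewrite ler_piMl// ltW.
(* The larger error is z - t <= c(2k+1) + k + 3 <= 3k + 4 <= 7k, using c <= 1 <= k. *)
have zt : `|t - z| <= 7 * y.
  rewrite ler_norml; apply/andP; split; nra.
have -> : 1 - z / t = (t - z) / t by rewrite mulrBl mulfV// gt_eqF.
rewrite normrM (@gtr0_norm _ t^-1) ?invr_gt0// ler_pdivrMr//.
apply: le_trans zt _; nra.
Unshelve. all: by end_near. Qed.

(* The sum is split at [y = x * exp (- sqrt (ln x))], which is o(x / ln x ^ l)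
   although [ln y ~ ln x]. *)
Lemma cvg_weight_ln_count b l (C : R) (f : R -> R) :
  (weight R (Num.truncn x) b)^-1 / ln x @[x --> +oo] --> (1 : R) ->
  (forall x, 1 <= x ->
     `|f x - \sum_(q < (Num.truncn x).-1) weight R q b ^+ l| <=
       C * expR (3 / 4 * ln x)) ->
  asymptotically_equal f (fun x => x / ln x ^+ l).
Proof.
move=> Wln fC.
pose w x := weight R (Num.truncn x) b.
have wln : w x * ln x @[x --> +oo] --> (1 : R).
  have := cvgV (oner_neq0 R) Wln; rewrite invr1 => h.
  pose k x := ((weight R (Num.truncn x) b)^-1 / ln x)^-1 : R.
  have k1 : k x @[x --> +oo] --> (1 : R) by exact: h.
  apply: (cvg_pinfty_near_eq _ k1).
  by apply: nearW => x; rewrite /k invfM !invrK.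
pose y x := expR (ln x - Num.sqrt (ln x)) : R.
have y_oo : y x @[x --> +oo] --> (+oo : set_system R).
  apply/cvgryPge => A.
  have : \forall t \near (+oo : set_system R), A <= expR (t - Num.sqrt t).
    near=> t; apply: le_trans (expR_ge1Dx _).
    have t0 : 0 <= t by near: t; exact: nbhs_pinfty_ge.
    have : 2 <= Num.sqrt t by near: t; exact: near_sqrt_ge.
    have : A <= Num.sqrt t by near: t; exact: near_sqrt_ge.
    have : t = Num.sqrt t ^+ 2 by rewrite sqr_sqrtr.
    move: (Num.sqrt t) => s -> sA s2; nra.
  exact: cvg_ln_pinfty.
have yratio : ln x / (ln x - Num.sqrt (ln x)) @[x --> +oo] --> (1 : R).
  suff h : t / (t - Num.sqrt t) @[t --> +oo] --> (1 : R).
    exact: (cvg_comp _ _ cvg_ln_pinfty h).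
  apply/cvgrPdist_le => e e0; near=> t.
  have t0 : 0 <= t by near: t; exact: nbhs_pinfty_ge.
  have : 2 <= Num.sqrt t by near: t; exact: near_sqrt_ge.
  have : e^-1 + 1 <= Num.sqrt t by near: t; exact: near_sqrt_ge.
  have : t = Num.sqrt t ^+ 2 by rewrite sqr_sqrtr.
  move: (Num.sqrt t) => s -> se s2.
  have s1 : 0 < s - 1 by lra.
  have -> : 1 - s ^+ 2 / (s ^+ 2 - s) = - (s - 1)^-1.
    by field; rewrite !gt_eqF//; nra.
  rewrite normrN gtr0_norm ?invr_gt0// -[leRHS]invrK lef_pV2 ?posrE ?invr_gt0//.
  by lra.
(* Since ln y ~ ln x, the weight at [y] is still asymptotic to 1/ln x. *)
have wy : w (y x) * ln x @[x --> +oo] --> (1 : R).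
  have h := cvg_comp _ _ y_oo wln.
  have := cvgM h yratio; rewrite mulr1 => {}h.
  pose k x := w (y x) * ln (y x) * (ln x / (ln x - Num.sqrt (ln x))).
  have k1 : k x @[x --> +oo] --> (1 : R) by exact: h.
  apply: (cvg_pinfty_near_eq _ k1); near=> x.
  have t0 : 2 <= Num.sqrt (ln x) by near: x; exact: (cvg_ln_pinfty (near_sqrt_ge 2)).
  have t1 : 0 <= ln x by near: x; exact: near_ln_ge.
  have ne : ln x - Num.sqrt (ln x) != 0.
    have : ln x = Num.sqrt (ln x) ^+ 2 by rewrite sqr_sqrtr.
    move: (Num.sqrt _) t0 => s s2 ->; rewrite gt_eqF//; nra.
  have lny : ln (y x) = ln x - Num.sqrt (ln x) by rewrite expRK.
  by rewrite /k lny -mulrA; congr (_ * _); rewrite mulrC divfK.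
have small : ln x ^+ l * expR (- Num.sqrt (ln x)) @[x --> +oo] --> (0 : R).
  exact: (cvg_comp _ _ cvg_ln_pinfty (@cvg_expr_expRN_sqrt l)).
(* This is the error C x^(3/4) divided by x/(ln x)^l; it is dominated by [small] once sqrt(ln x) >=
   4. *)
have small4 : C * (ln x ^+ l * expR (- (ln x / 4))) @[x --> +oo] --> (0 : R).
  suff h : ln x ^+ l * expR (- (ln x / 4)) @[x --> +oo] --> (0 : R).
    by have := cvgMl_tmp (a := C) h; rewrite mulr0; exact.
  apply: (squeeze_cvgr _ (cvg_cst (0 : R)) small); near=> x.
  have t0 : 4 <= Num.sqrt (ln x) by near: x; exact: (cvg_ln_pinfty (near_sqrt_ge 4)).
  have t1 : 0 <= ln x by near: x; exact: near_ln_ge.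
  rewrite mulr_ge0 ?exprn_ge0 ?expR_ge0//= ler_wpM2l ?exprn_ge0// ler_expR lerN2.
  have : ln x = Num.sqrt (ln x) ^+ 2 by rewrite sqr_sqrtr.
  by move: (Num.sqrt _) t0 => s s2 ->; nra.
have powl (h : R -> R) : h x @[x --> +oo] --> (1 : R) ->
    h x ^+ l @[x --> +oo] --> (1 : R).
  by move=> h1; have := cvg_comp _ _ h1 (@exprn_continuous R l 1); rewrite expr1n; exact.
rewrite /asymptotically_equal.
(* The lower bound takes the weight at [x] for all terms, and 2/x pays for the rounding and the
   predecessor; the upper bound splits the sum at [y]. *)
apply: (@squeeze_cvgr _ _ _ _
  (fun x : R => (1 - 2 / x) * (w x * ln x) ^+ l - C * (ln x ^+ l * expR (- (ln x / 4))))
  (fun x : R => ln x ^+ l * expR (- Num.sqrt (ln x)) + (w (y x) * ln x) ^+ l +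
      C * (ln x ^+ l * expR (- (ln x / 4))))).
- near=> x.
  have x2 : 2 <= x by near: x; exact: nbhs_pinfty_ge.
  have x0 : 0 < x by lra.
  have t0 : 0 < ln x by rewrite ln_gt0//; lra.
  have tl : 0 < ln x ^+ l by rewrite exprn_gt0.
  have xE : x = expR (ln x) by rewrite lnK.
  have E : expR (- (ln x / 4)) = expR (3 / 4 * ln x) / x.
    by rewrite [X in _ = _ / X]xE -expRB; congr expR; lra.
  have xtl : 0 < x / ln x ^+ l by rewrite divr_gt0.
  have := fC x; have -> : (1 <= x) by lra.
  move=> /(_ isT); rewrite ler_distl => /andP[f1 f2].
  have w0 z : 0 <= w z by rewrite ltW// weight_gt0.
  have n1 : x - 2 <= (Num.truncn x).-1%:R.
    have : (0 < Num.truncn x)%N by rewrite truncn_gt0; lra.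
    have := truncnS_gt x; case: (Num.truncn x) => // m; rewrite /= -!natr1; lra.
  have n2 : (Num.truncn x).-1%:R <= x.
    apply: (@le_trans _ _ (Num.truncn x)%:R); first by rewrite ler_nat leq_pred.
    by rewrite truncn_le ltW.
  have lo : (x - 2) * w x ^+ l <= \sum_(q < (Num.truncn x).-1) weight R q b ^+ l.
    apply: le_trans (sum_weight_ge R l b (leq_pred _)).
    by rewrite ler_wpM2r// exprn_ge0.
  have hi : \sum_(q < (Num.truncn x).-1) weight R q b ^+ l <= y x + x * w (y x) ^+ l.
    apply: le_trans (sum_weight_le R l _ (Num.truncn (y x)) b) _.
    apply: lerD; first by rewrite truncn_le expR_ge0.
    by apply: ler_wpM2r n2; exact: exprn_ge0 (w0 _).
  have yE : expR (- Num.sqrt (ln x)) = y x / x.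
    by rewrite /y [X in _ = _ / X]xE -expRB; congr expR; lra.
  rewrite ler_pdivlMr// ler_pdivrMr// E yE !exprMn; apply/andP; split.
  + apply: (le_trans _ f1); apply: le_trans (lerB lo (lexx _)).
    rewrite le_eqVlt; apply/orP; left; apply/eqP.
    by field; rewrite !gt_eqF.
  + apply: (le_trans f2 _); apply: (le_trans (lerD hi (lexx _)) _).
    rewrite le_eqVlt; apply/orP; left; apply/eqP.
    by field; rewrite !gt_eqF.
- have i0 : x^-1 @[x --> +oo] --> (0 : R).
    apply/gtr0_cvgV0; first exact: nbhs_pinfty_gt.
    exact: cvg_id.
  have h2 : 2 / x @[x --> +oo] --> (0 : R).
    by have := cvgMl_tmp (a := 2) i0; rewrite mulr0; exact.
  have h1 : 1 - 2 / x @[x --> +oo] --> (1 : R).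
    by have := cvgB (cvg_cst (1 : R)) h2; rewrite subr0; exact.
  by have := cvgB (cvgM h1 (powl _ wln)) small4; rewrite mulr1 subr0; exact.
- by have := cvgD (cvgD small (powl _ wy)) small4; rewrite add0r addr0; exact.
Unshelve. all: by end_near. Qed.

End Asymptotics.

(** * From the bits to progression counts and the theorem *)

(** A start m <= x is q+2 with q < floor(x) - 1; as 0 < l, the start itself belongs to [alpha],
    hence m >= 2. *)
Lemma progression_countE (R : realType) (d l : nat) (x : R) (alpha : sieve_space) :
  (0 < l)%N -> 0 <= x ->
  (progression_count d l x alpha)%:R =
  \sum_(q < (Num.truncn x).-1) \prod_(i < l) (bits alpha (q + i * d)%N)%:R :> R.
Proof.
move=> l0 x0.
pose P q := [forall i : 'I_l, bits alpha (q + i * d)%N].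
have PE q : \prod_(i < l) (bits alpha (q + i * d)%N)%:R = (P q)%:R :> R.
  rewrite /P; case: forallP => [Pq|nP]; first by rewrite big1// => i _; rewrite Pq.
  have [i ni] : exists i : 'I_l, ~~ bits alpha (q + i * d)%N.
    by apply/existsP; rewrite -negb_forall; apply/forallP.
  by rewrite (bigD1 i)//= (negbTE ni) mul0r.
under eq_bigr do rewrite PE.
set n := (Num.truncn x).-1.
pose A : {fset nat} := seq_fset tt [seq q.+2 | q <- iota 0 n & P q].
rewrite /progression_count; have -> : [set m : nat | m%:R <= x /\
    [set (m + i * d)%N | i in [set i | (i < l)%N]] `<=` terms alpha] = [set` A].
  apply/seteqP; split=> m /=; rewrite seq_fsetE.
    case=> mx sub.
    have tm : terms alpha m by apply: sub; exists 0%N => //; rewrite mul0n addn0.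
    have m2 : (2 <= m)%N.
      by have /set_mem := valP alpha; exact.
    apply/mapP; exists m.-2; last by lia.
    rewrite mem_filter mem_iota /= add0n; apply/andP; split.
      apply/forallP => i; apply/asboolP.
      by apply: sub; exists i => //=; lia.
    by rewrite -truncn_ge_nat// in mx; rewrite /n; lia.
  case/mapP => q; rewrite mem_filter mem_iota /= add0n => /andP[/forallP Pq qn] ->.
  split; first by rewrite -truncn_ge_nat//; rewrite /n in qn; lia.
  by move=> _ [i /= il <-]; have /asboolP := Pq (Ordinal il).
rewrite set_fsetK size_seq_fset undup_id; last first.
  by rewrite map_inj_uniq ?filter_uniq ?iota_uniq// => a c [].
rewrite size_map size_filter -sum1_count -[n in iota 0 n]subn0 -/(index_iota 0 n).
rewrite big_mkord natr_sum [LHS]big_mkcond /=.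
by apply: eq_bigr => q _; case: (P q).
Qed.

Lemma ae_weight_inv (R : realType) (mu : probability sieveType R) :
  is_hawkins_measure mu ->
  {ae mu, forall alpha : sieveType, exists K, forall k, (K <= k)%N ->
    `|(weight R (2 ^ (k ^ 2)) (bits alpha))^-1 - harm R (2 ^ (k ^ 2))| < k.+1%:R}.
Proof.
move=> hmu; apply: (ae_eventually_lt hmu (C := 3) (n := fun k => (2 ^ (k ^ 2))%N)
  (f := fun k b => (weight R (2 ^ (k ^ 2)) b)^-1 - harm R (2 ^ (k ^ 2)))).
- by move=> k b b' e; rewrite (weight_depends R e).
- by move=> k; exact: expect_weight_inv_var_le3.
Qed.

(** The second moment at time k^4 is at most k^4, so division by k^2 normalises it to 1 and the
    quotient is eventually below k. *)
Lemma ae_centered_sum (R : realType) (mu : probability sieveType R)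
    (g : nat -> (nat -> bool) -> R) : is_hawkins_measure mu ->
  (forall i, depends_before i (g i)) -> (forall i b, `|g i b| <= 1) ->
  {ae mu, forall alpha : sieveType, exists K, forall k, (K <= k)%N ->
    `|centered_sum g (k ^ 4) (bits alpha)| <= k%:R ^+ 3}.
Proof.
move=> hmu gP g1.
have : {ae mu, forall alpha : sieveType, exists K, forall k, (K <= k)%N ->
    `|(k.+1%:R ^+ 2)^-1 * centered_sum g (k.+1 ^ 4) (bits alpha)| < k.+1%:R}.
  apply: (ae_eventually_lt hmu (C := 1) (n := fun k => (k.+1 ^ 4)%N)
    (f := fun k b => (k.+1%:R ^+ 2)^-1 * centered_sum g (k.+1 ^ 4) b)).
    by move=> k b b' e; rewrite (centered_sum_depends gP e).
  move=> k; under eq_expect do rewrite exprMn.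
  rewrite expectZ exprVn -exprM ler_pdivrMl ?exprn_gt0// mulr1 -natrX.
  exact: expect_centered_sum2.
apply: filterS => alpha [K HK]; exists K.+1 => -[//|k]; rewrite ltnS => /HK.
rewrite normrM ger0_norm ?invr_ge0 ?exprn_ge0// mulrC ltr_pdivrMr ?exprn_gt0//.
by rewrite -exprS => /ltW.
Qed.

Theorem corollary1 (R : realType) (mu : probability sieveType R)
    (hmu : is_hawkins_measure mu) (d l : nat) (hd : (1 <= d)%N)
    (hl : (2 <= l)%N) :
  {ae mu, forall alpha : sieveType,
    asymptotically_equal
      (fun x : R => (progression_count d l x alpha)%:R)
      (fun x : R => x / ln x ^+ l)}.
Proof.
(* A countable intersection provides one null set for all [j]. *)
have aeS : {ae mu, forall alpha : sieveType, forall j, exists K, forall k,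
    (K <= k)%N ->
    `|centered_sum (partial_pattern R d l j) (k ^ 4) (bits alpha)| <= k%:R ^+ 3}.
  apply: ae_foralln => j; apply: ae_centered_sum => //.
  - by move=> i; exact: partial_pattern_depends.
  - by move=> i b; exact: partial_pattern_le1.
apply: filterS2 (ae_weight_inv hmu) aeS => alpha [K HK] HS.
have {}HS j : exists C, 0 <= C /\ forall n x, 1 <= x -> n%:R <= x ->
    `|centered_sum (partial_pattern R d l j) (j * d + n) (bits alpha)| <=
      C * expR (3 / 4 * ln x).
  have [Kj HKj] := HS j.
  have [||C C0 HC] := @lipschitz_growth R
    (fun n => centered_sum (partial_pattern R d l j) n (bits alpha))
    (j * d) Kj _ _ HKj.
  - by rewrite /centered_sum big_ord0.
  - by move=> n m; apply: centered_sum_lipschitz => i b; exact: partial_pattern_le1.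
  - by exists C.
have [C HC] := choice HS.
apply: (@cvg_weight_ln_count _ (bits alpha) l
    ((l * (l * d))%:R * 2 + \sum_(j < l) C j)); first exact: weight_inv_ln HK.
move=> x x1; rewrite progression_countE ?(ltnW hl)// ?(le_trans ler01)//.
have x0 : 0 < x by exact: lt_le_trans ltr01 x1.
set n := (Num.truncn x).-1.
have nx : n%:R <= x.
  apply: (@le_trans _ _ (Num.truncn x)%:R); first by rewrite ler_nat leq_pred.
  by rewrite truncn_le ltW.
have t0 : 0 <= ln x by exact: ln_ge0.
(* Logarithmic growth is absorbed into x^(3/4) through 1 + u <= e^u at u = (3/4) ln x. *)
have hn : harm R n <= 2 * expR (3 / 4 * ln x).
  apply: (@le_trans _ _ (1 + ln x)); last by have := expR_ge1Dx (3 / 4 * ln x); lra.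
  case: n nx => [|m] nx; first by rewrite /harm big_ord0; lra.
  have [_ h] := ln_harm R m; apply: le_trans h _.
  by rewrite lerD2l ler_ln ?posrE.
have := pattern_sum_dist R d l n (bits alpha).
set S1 := \sum_(q < n) _; set S2 := \sum_(q < n) _.
set S3 := \sum_(j < l) centered_sum _ _ _ => h.
have h3 : `|S3| <= (\sum_(j < l) C j) * expR (3 / 4 * ln x).
  apply: le_trans (ler_norm_sum _ _ _) _; rewrite mulr_suml.
  by apply: ler_sum => j _; have [_ HCj] := HC j; exact: HCj.
rewrite -[S1 - S2](subrK S3) mulrDl; apply: le_trans (ler_normD _ _) _.
apply: lerD h3; apply: le_trans h _.
by rewrite -[leRHS]mulrA; apply: ler_wpM2l hn.
Qed.
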